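(* Let $d\geqslant 3$ be an odd integer and let $n$ be a positive integer with $n\equiv \frac{1}{2}\pmod{d}$. Then, modulo $\Phi_n(q)(1-aq^n)(a-q^n)$, $$\sum_{k=0}^{n-1}[2dk-1]\frac{(a^{d-2}q^{-1}, a^{d-4}q^{-1},\ldots, aq^{-1};q^d)_k\,(a^{2-d}q^{-1}, a^{4-d}q^{-1},\ldots,a^{-1}q^{-1};q^d)_k\, (q^{-1};q^d)_k}{(a^{d-2}q^d, a^{d-4}q^d,\ldots,aq^d;q^d)_k\,(a^{2-d}q^d, a^{4-d}q^d,\ldots, a^{-1}q^d;q^d)_k\, (q^d;q^d)_k}\,q^{\frac{d(d-1)k}{2}} \equiv 0.$$
   Context: Here $q$ and $a$ are independent indeterminates. Notation: $(x;q)_k=(1-x)(1-xq)\cdots(1-xq^{k-1})$ for $k\ge 1$, $(x;q)_0=1$, and $(x_1,\ldots,x_m;q)_k=(x_1;q)_k\cdots(x_m;q)_k$ (so $(x;q^d)_k=\prod_{i=0}^{k-1}(1-xq^{di})$). For an integer $m$ (possibly negative), $[m]=\frac{1-q^m}{1-q}$; in particular $[-1]=-q^{-1}$. $\Phi_n(q)$ is the $n$-th cyclotomic polynomial in $q$. The condition $n\equiv \frac12\pmod d$ (with $d$ odd) means $2n\equiv 1\pmod d$. In each list the exponents of $a$ change in steps of $2$: in both numerator and denominator the exponents of $a$ are $\pm1,\pm3,\ldots,\pm(d-2)$ and $0$. For a rational function $A(a,q)$ and a polynomial $P(a,q)$, $A\equiv 0$ modulo $P$ means that $A=PU/V$ with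 polynomials $U,V$ in $a,q$ (over $\mathbb{Q}$), where $V$ is relatively prime to $P$. *)

(* Defs.v *)
From HB Require Import structures.
From mathcomp Require Import all_boot all_order all_algebra all_field.

Set Implicit Arguments.
Unset Strict Implicit.
Unset Printing Implicit Defensive.

Import GRing.Theory.
Local Open Scope ring_scope.

(* Q[a, q], encoded as Q[q][a]: the outer variable is a, the inner one is q. *)
Definition polyaq : idomainType := {poly {poly rat}}.
Definition ratfaq : fieldType := {fraction polyaq}.

Definition pa : polyaq := 'X.
Definition pq : polyaq := ('X : {poly rat})%:P.

Definition tof (P : polyaq) : ratfaq := @FracField.tofrac polyaq P.

Definition fa : ratfaq := tof pa.
Definition fq : ratfaq := tof pq.

Definition Phiq (n : nat) : polyaq :=
  (map_poly (intr : int -> rat) ('Phi_n))%:P.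

Section QNotation.
Variable F : fieldType.

(* (x; q)_k *)
Definition qpoch (x q : F) (k : nat) : F := \prod_(i < k) (1 - x * q ^+ i).

(* (x_1, ..., x_m; q)_k *)
Definition qpochs (xs : seq F) (q : F) (k : nat) : F :=
  \prod_(x <- xs) qpoch x q k.

(* [m], for a possibly negative integer m *)
Definition qint (q : F) (m : int) : F := (1 - q ^ m) / (1 - q).

(* The lists a^(d-2) c, a^(d-4) c, ..., a c  and
   a^(2-d) c, a^(4-d) c, ..., a^(-1) c, for odd d. *)
Definition apos (d : nat) (a c : F) : seq F :=
  [seq a ^+ (d - 2 * j.+1) * c | j <- iota 0 d.-1./2].
Definition aneg (d : nat) (a c : F) : seq F :=
  [seq a ^- (d - 2 * j.+1) * c | j <- iota 0 d.-1./2].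

End QNotation.

Definition divides (R : comUnitRingType) (D P : R) : Prop :=
  exists S : R, P = D * S.

(* No common factor other than units. The library's coprimep is not suitable
   here: over the coefficient ring Q[q] it ignores common factors of degree 0
   in the outer variable a. *)
Definition relprime (R : comUnitRingType) (P Q : R) : Prop :=
  forall D : R, divides D P -> divides D Q -> D \is a GRing.unit.

(* V != 0 already follows from relprime V P when P is not a unit; it is there
   because inversion in ratfaq is total. *)
Definition congr0 (A : ratfaq) (P : polyaq) : Prop :=
  exists U V : polyaq,
    [/\ V != 0, relprime V P & A = tof (P * U) / tof V].

(* Main.v *)
Require Import Defs.
From HB Require Import structures.
From mathcomp Require Import all_boot all_order all_algebra all_field.
From mathcomp Require Import ring zify.
Import GRing.Theory.
Local Open Scope ring_scope.

(** The sum is a very-well-poised basic hypergeometric series in base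
    p = q^d with leading parameter A = 1/q: its numerator parameters are A z
    and its denominator parameters p / z, where z runs over 1 and the odd
    powers a^j with |j| <= d - 2 (this set is stable under inversion, so the
    denominators may as well be written p z).

    Write d = 2g + 3, n = d mu + g + 2 and N = n - (2 mu + 1), so that
    d N = (d - 2) n + 1.  Each factor of the modulus generates the kernel of a
    ring morphism from Q[q][a] to the field C(X): the cyclotomic factor, of the
    one sending q to a primitive n-th root of unity and a to X; the other two,
    of the ones sending q to X and a to X^-n or X^n.  A fraction whose
    denominator survives these three morphisms and which all three send to 0
    has a numerator divisible by the three factors in turn
    ([divides_mul_kernel]), and a denominator coprime to their product
    ([relprime_mul_kernel]).  What remains is to see the sum vanish at the
    three places.

    At a = q^n ([sum_summand_qn_eq0]).  The parameter z = a^(2-d) gives the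
    numerator (p^-N; p)_k, which ends the series at k = N, and the denominator
    of z = a^(d-2) in the form above is (A p^(N+1); p)_k.  Each of the other
    d - 2 numerator parameters is p^(2 mu) times one of the other d - 2
    denominator parameters, so their quotient is a polynomial in p^k
    ([qpoch_shift_ratio]).  Its roots are exchanged in pairs by
    x -> 1 / (A x), so up to a power of p^k it is a polynomial f of degree
    (d - 2) mu < N in y_k = p^-k + A p^k ([prod_qpoch_node]).  The other
    factors amount to the Lagrange weight 1 / prod_(l <> k) (y_k - y_l)
    ([wp_weight]), and the sum is, up to a constant, the divided difference of
    f at the N + 1 points y_0, ..., y_N: it is 0.  The case a = q^-n follows,
    the summand being invariant under a -> 1/a.

    At a primitive n-th root of unity ([sum_summand_root_eq0]).  There
    p^N = q, hence A = p^-N: the terms with k > N contain the factor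
    1 - A p^N = 0, and reversing the shifted factorials shows that the terms
    of index k and N - k are opposite ([summand_antisym]). *)

Set Implicit Arguments.
Unset Strict Implicit.
Unset Printing Implicit Defensive.

(** * Shifted factorials and divided differences *)

Section QPochhammer.
Variable F : fieldType.
Implicit Types (x q b p : F) (k l m : nat).

Lemma qpochD x q k l :
  qpoch x q (k + l) = qpoch x q k * qpoch (x * q ^+ k) q l.
Proof.
rewrite /qpoch big_split_ord /=; congr (_ * _).
by apply: eq_bigr => i _; rewrite exprD mulrA.
Qed.

Lemma qpoch_rev x q k :
  qpoch x q k = \prod_(i < k) (1 - x * q ^+ (k - i.+1)).
Proof. by rewrite /qpoch (reindex_inj rev_ord_inj). Qed.

Lemma qpoch_neq0 x q k :
  (forall i, (i < k)%N -> x * q ^+ i != 1) -> qpoch x q k != 0.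
Proof.
by move=> H; apply/prodf_neq0 => i _; rewrite subr_eq0 eq_sym H.
Qed.

Lemma qpoch_eq0 x q k i : (i < k)%N -> x * q ^+ i = 1 -> qpoch x q k = 0.
Proof. by move=> ik H; rewrite /qpoch (bigD1 (Ordinal ik)) //= H subrr mul0r. Qed.

(** Both sides are (b; p)_(m+k) / ((b; p)_k (b; p)_m).  For fixed m the right
    hand side is a polynomial of degree m in p^k: this is what makes a
    parameter pair differing by an integral power of p harmless in a sum. *)
Lemma qpoch_shift_ratio b p m k :
  (forall i, b * p ^+ i != 1) ->
  qpoch (b * p ^+ m) p k / qpoch b p k = qpoch (b * p ^+ k) p m / qpoch b p m.
Proof.
move=> nz; have nzb j : qpoch b p j != 0 by apply: qpoch_neq0.
by apply/eqP; rewrite eqr_div // ![_ * qpoch b p _]mulrC -!qpochD addnC.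
Qed.

(** The sum is the coefficient of degree N of the polynomial of degree at most
    N interpolating f at the nodes, and that polynomial is f itself. *)
Lemma divided_difference_eq0 N (y : nat -> F) (f : {poly F}) :
  injective y -> (size f <= N)%N ->
  \sum_(k < N.+1) f.[y k] / \prod_(l < N.+1 | l != k) (y k - y l) = 0.
Proof.
move=> y_inj sf.
have /(congr1 (fun g : {poly F} => g`_N)) :=
  lagrange_gen (ltn0Sn N) y_inj (leqW sf).
rewrite nth_default // coef_sum => E; rewrite [RHS]E {E}; apply: eq_bigr => k _.
rewrite lagrangeE //= mulrA -polyCM coefCM horner_prod.
have -> : \prod_(l < N.+1 | l != k) ('X - (y l)%:P)
        = \prod_(l <- enum (predC1 k)) ('X - (y l)%:P).
  by rewrite big_enum; apply: eq_bigl.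
have szk : size (enum (predC1 k)) = N by rewrite -cardE cardC1 card_ord.
have /monicP := monic_prod_XsubC (enum (predC1 k)) xpredT (fun l : 'I_N.+1 => y l).
rewrite /lead_coef size_prod_XsubC szk [N.+1.-1]/= => ->; rewrite mulr1.
by congr (_ / _); apply: eq_bigr => l _; rewrite hornerXsubC.
Qed.
End QPochhammer.

Lemma prod_ord_skip (R : comNzRingType) (G : nat -> R) k N : (k <= N)%N ->
  \prod_(l < N.+1 | l != k :> nat) G l =
  \prod_(i < k) G i * \prod_(i < N - k) G (k.+1 + i)%N.
Proof.
move=> /subnKC; set r := (N - k)%N => <-.
rewrite -addnS big_split_ord /=; congr (_ * _).
  by apply: eq_bigl => i; rewrite neq_ltn ltn_ord.
rewrite big_mkcond big_ord_recl /= addn0 eqxx mul1r.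
by apply: eq_bigr => i _; rewrite /bump /= !addnA addn1 -[X in _ != X]addn0 addSnnS eqn_add2l.
Qed.

Lemma expVD (F : fieldType) (p : F) m s : p != 0 -> p ^- (m + s) * p ^+ s = p ^- m.
Proof. by move=> p0; rewrite exprD invfM mulfVK ?expf_neq0. Qed.

(** * Very-well-poised weights as Lagrange weights *)

Section Weights.
Variables (F : fieldType) (p A : F).
Hypothesis p_neq0 : p != 0.

(** The generator of the functions of x = p^k invariant under x -> 1 / (A x). *)
Definition wp_node k : F := p ^- k + A * p ^+ k.

Lemma wp_nodeB k l :
  wp_node k - wp_node l =
  p ^- k * (1 - p ^+ k / p ^+ l) * (1 - A * p ^+ (k + l)).
Proof.
have pk : p ^+ k != 0 by rewrite expf_neq0.
have pl : p ^+ l != 0 by rewrite expf_neq0.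
by rewrite /wp_node exprD; field; rewrite pk pl.
Qed.

(** By [wp_nodeB] the product of the differences splits into a power of p and
    two shifted factorials with one factor missing: the factors
    1 - A p^(k+l) run over (A p^k; p)_(N+1) without 1 - A p^(2k), which is
    where the very-well-poised factor comes from, and the factors 1 - p^(k-l)
    form (p; p)_k for l < k and the end of (p^-N; p)_N for l > k. *)
Lemma wp_weight N k : (k <= N)%N ->
  (\prod_(l < N.+1 | l != k :> nat) (wp_node k - wp_node l))
  * (p ^+ (k * N) * (1 - A * p ^+ (2 * k)) * qpoch A p k * qpoch (p ^- N) p k)
  = qpoch p p k * qpoch (A * p ^+ N.+1) p k
    * (qpoch A p N.+1 * qpoch (p ^- N) p N).
Proof.
move=> kN.
have kN1 : (k < N.+1)%N by [].
under eq_bigr do rewrite wp_nodeB.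
rewrite !big_split /=.
have -> : \prod_(l < N.+1 | l != k :> nat) p ^- k = p ^- (k * N).
  rewrite prodr_const exprM exprVn; congr (_ ^- _).
  by transitivity #|predC1 (Ordinal kN1)|; [exact: eq_card | rewrite cardC1 card_ord].
have E3 : \prod_(l < N.+1 | l != k :> nat) (1 - A * p ^+ (k + l))
          * (1 - A * p ^+ (2 * k)) * qpoch A p k
        = qpoch A p N.+1 * qpoch (A * p ^+ N.+1) p k.
  rewrite -qpochD [(N.+1 + k)%N]addnC qpochD mulrC; congr (_ * _).
  rewrite [RHS](bigD1 (Ordinal kN1)) //= mulrC mul2n -addnn.
  by rewrite -mulrA -exprD; congr (_ * _); apply: eq_bigr => l _;
     rewrite -mulrA -exprD.
have E2 : \prod_(l < N.+1 | l != k :> nat) (1 - p ^+ k / p ^+ l)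
          * qpoch (p ^- N) p k
        = qpoch p p k * qpoch (p ^- N) p N.
  have -> : qpoch (p ^- N) p N
          = qpoch (p ^- N) p k * qpoch (p ^- N * p ^+ k) p (N - k).
    by rewrite -qpochD subnKC.
  rewrite mulrCA mulrC; congr (_ * _).
  rewrite (@prod_ord_skip _ (fun l => 1 - p ^+ k / p ^+ l)) //.
  congr (_ * _).
    rewrite qpoch_rev; apply: eq_bigr => i _; congr (1 - _).
    apply: (canLR (mulfK _)); first by rewrite expf_neq0.
    by rewrite -exprS -exprD; congr (_ ^+ _); have := ltn_ord i; lia.
  rewrite qpoch_rev; apply: eq_bigr => i _; congr (1 - _).
  have EN : N = (k.+1 + i + (N - k - i.+1))%N by have := ltn_ord i; lia.
  by rewrite [in p ^- N]EN mulrAC expVD // mulrC.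
have pk0 : p ^+ (k * N) != 0 by rewrite expf_neq0.
transitivity ((\prod_(l < N.+1 | l != k :> nat) (1 - A * p ^+ (k + l))
          * (1 - A * p ^+ (2 * k)) * qpoch A p k) *
   (\prod_(l < N.+1 | l != k :> nat) (1 - p ^+ k / p ^+ l)
          * qpoch (p ^- N) p k)).
  by field.
by rewrite E2 E3; ring.
Qed.

Lemma wp_sum_eq0 N (f : {poly F}) :
  injective wp_node -> (size f <= N)%N ->
  (forall k, (k <= N)%N -> qpoch p p k * qpoch (A * p ^+ N.+1) p k != 0) ->
  \sum_(k < N.+1) (1 - A * p ^+ (2 * k)) * qpoch A p k * qpoch (p ^- N) p k
    / (qpoch p p k * qpoch (A * p ^+ N.+1) p k) * p ^+ (k * N) * f.[wp_node k]
  = 0.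
Proof.
move=> y_inj sf nz.
pose C := qpoch A p N.+1 * qpoch (p ^- N) p N.
transitivity (C * \sum_(k < N.+1) f.[wp_node k]
    / \prod_(l < N.+1 | l != k) (wp_node k - wp_node l)).
  rewrite big_distrr; apply: eq_bigr => k _.
  have kN : (k <= N)%N by rewrite -ltnS.
  have P0 : \prod_(l < N.+1 | l != k) (wp_node k - wp_node l) != 0.
    apply/prodf_neq0 => l lk; rewrite subr_eq0; apply: contraNneq lk.
    by move/y_inj => E; apply/eqP/val_inj.
  have := wp_weight kN; move: (nz _ kN) P0; rewrite -/C.
  set D := qpoch p p k * _; set P := \prod_(l < _ | _) _ => D0 P0.
  set q1 := qpoch A p k; set q2 := qpoch _ p k; set w := 1 - _; set v := p ^+ _.
  move=> E; have -> : C = P * (v * w * q1 * q2) / D by rewrite E mulrC mulKf.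
  by rewrite /=; field; rewrite D0 P0.
by rewrite divided_difference_eq0 // mulr0.
Qed.
End Weights.

(** * The summand *)

(** For i < 2g + 2 these are the odd powers a^(2i - 2g - 1), in increasing
    order; reversing i inverts them. *)
Definition a_power (F : fieldType) g (a : F) i : F := a ^+ (2 * i) / a ^+ (2 * g).+1.

(** The two lists of powers of a are merged here, and d = 2g + 3 avoids the
    truncated subtractions d - 1 and d - 2. *)
Definition summand (F : fieldType) g (a q : F) k : F :=
  let p := q ^+ (2 * g + 3) in
  (1 - q^-1 * p ^+ (2 * k)) / (1 - q)
  * (\prod_(i < 2 * g + 2)
       (qpoch (a_power g a i * q^-1) p k / qpoch (a_power g a i * p) p k)
     * (qpoch q^-1 p k / qpoch p p k))
  * p ^+ (g.+1 * k).

Lemma prod_apos_aneg (F : fieldType) g (a c : F) (G : F -> F) : a != 0 ->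
  \prod_(x <- apos (2 * g + 3) a c) G x * \prod_(x <- aneg (2 * g + 3) a c) G x
  = \prod_(i < 2 * g + 2) G (a_power g a i * c).
Proof.
move=> a0; have Eh : (2 * g + 3).-1./2 = g.+1 by lia.
have E2 : (2 * g + 2 = g.+1 + g.+1)%N by lia.
rewrite /apos /aneg Eh !big_map -[iota 0 g.+1]/(index_iota 0 g.+1) !big_mkord.
rewrite E2 big_split_ord mulrC /=; congr (_ * _).
  apply: eq_bigr => i _; congr (G (_ * _)); have := ltn_ord i => li.
  rewrite /a_power; have -> : ((2 * g).+1 = (2 * g + 3 - 2 * i.+1) + 2 * i)%N by lia.
  by rewrite mulrC expVD.
rewrite (reindex_inj rev_ord_inj); apply: eq_bigr => i _; congr (G (_ * _)).
have := ltn_ord i => li; apply: (canRL (mulfK _)); first by rewrite expf_neq0.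
by rewrite -exprD /=; congr (_ ^+ _); lia.
Qed.

Lemma qint_predE (F : fieldType) (q : F) m : q != 0 ->
  qint q (m%:Z - 1) = (1 - q^-1 * q ^+ m) / (1 - q).
Proof. by move=> q0; rewrite /qint expfzDr // exprN1 -exprnP [_ * q^-1]mulrC. Qed.

Lemma summandE (F : fieldType) g (a q : F) k : a != 0 -> q != 0 ->
  qint q ((2 * (2 * g + 3) * k)%N%:Z - 1)
  * ((qpochs (apos (2 * g + 3) a q^-1) (q ^+ (2 * g + 3)) k
      * qpochs (aneg (2 * g + 3) a q^-1) (q ^+ (2 * g + 3)) k
      * qpoch q^-1 (q ^+ (2 * g + 3)) k)
     / (qpochs (apos (2 * g + 3) a (q ^+ (2 * g + 3))) (q ^+ (2 * g + 3)) k
        * qpochs (aneg (2 * g + 3) a (q ^+ (2 * g + 3))) (q ^+ (2 * g + 3)) k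
        * qpoch (q ^+ (2 * g + 3)) (q ^+ (2 * g + 3)) k))
  * q ^+ ((2 * g + 3) * (2 * g + 3 - 1) * k %/ 2)%N
  = summand g a q k.
Proof.
move=> a0 q0; rewrite qint_predE // /qpochs !prod_apos_aneg // -mulf_div -prodf_div /summand.
rewrite -!exprM; congr ((1 - _ * q ^+ _) / _ * _ * q ^+ _); first by lia.
have -> : ((2 * g + 3) * (2 * g + 3 - 1) * k = (2 * g + 3) * (g.+1 * k) * 2)%N.
  have -> : (2 * g + 3 - 1 = 2 * g.+1)%N by lia.
  lia.
by rewrite mulnK.
Qed.

Lemma a_power_inv (F : fieldType) g (a : F) i :
  a_power g a^-1 i = (a_power g a i)^-1.
Proof. by rewrite /a_power !exprVn invf_div invrK mulrC. Qed.

Lemma a_powerV (F : fieldType) g (a : F) (i : 'I_(2 * g + 2)) : a != 0 ->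
  a_power g a^-1 i = a_power g a (rev_ord i).
Proof.
move=> a0; have li := ltn_ord i.
rewrite /a_power !exprVn invrK mulrC; apply/eqP; rewrite eqr_div ?expf_neq0 //.
by rewrite -!exprD; apply/eqP; congr (_ ^+ _) => /=; lia.
Qed.

Lemma summandV (F : fieldType) g (a q : F) k : a != 0 ->
  summand g a^-1 q k = summand g a q k.
Proof.
move=> a0; rewrite /summand; congr (_ * (_ * _) * _).
rewrite [RHS](reindex_inj rev_ord_inj); apply: eq_bigr => i _.
by rewrite a_powerV.
Qed.

(** * Vanishing when a is the n-th power of q or of its inverse *)

Section SelfReciprocal.
Variables (F : fieldType) (p A : F) (T mu : nat) (b : 'I_T -> F).
Hypotheses (p_neq0 : p != 0)
  (b_rev : forall i, b i * b (rev_ord i) * p ^+ (2 * mu) = A * p).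

(** The numbers c = b_i p^l with l < 2 mu fall into pairs of product A, the
    partner of (i, l) being obtained by reversing both indices.  As
    (1 - c x) (1 - A x / c) = x (1/x + A x - (c + A / c)), each pair gives one
    root c + A / c, and the pairs are listed by i and l < mu. *)
Definition node_poly : {poly F} :=
  \prod_(u : 'I_T * 'I_mu)
    ('X - (b u.1 * p ^+ u.2
           + b (rev_ord u.1) * p ^+ (mu + rev_ord u.2))%:P).

Lemma size_node_poly : size node_poly = (T * mu).+1.
Proof.
by rewrite /node_poly -big_enum size_prod_XsubC -cardE card_prod !card_ord.
Qed.

Lemma prod_qpoch_node k :
  \prod_(i < T) qpoch (b i * p ^+ k) p (2 * mu)
  = p ^+ (k * (T * mu)) * node_poly.[wp_node p A k].
Proof.
have -> : \prod_(i < T) qpoch (b i * p ^+ k) p (2 * mu)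
  = \prod_(i < T) \prod_(l < mu) ((1 - b i * p ^+ k * p ^+ l)
     * (1 - b (rev_ord i) * p ^+ k * p ^+ (mu + rev_ord l))).
  under [RHS]eq_bigr do rewrite big_split.
  rewrite mul2n -addnn /= big_split /=.
  rewrite [X in _ * X](reindex_inj rev_ord_inj) /= -big_split /=.
  apply: eq_bigr => i _; rewrite rev_ordK /qpoch big_split_ord; congr (_ * _).
  by rewrite (reindex_inj rev_ord_inj).
rewrite pair_bigA /= /node_poly horner_prod.
have -> : p ^+ (k * (T * mu)) = \prod_(u : 'I_T * 'I_mu) p ^+ k.
  by rewrite prodr_const card_prod !card_ord exprM.
rewrite -big_split; apply: eq_bigr => -[i l] _ /=; rewrite hornerXsubC /wp_node.
have E : b i * p ^+ l * (b (rev_ord i) * p ^+ (mu + (mu - l.+1))) = A.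
  apply: (mulIf p_neq0); rewrite -(b_rev i).
  have -> : (2 * mu = mu + l + (mu - l.+1) + 1)%N by have := ltn_ord l; lia.
  by rewrite !exprD expr1; ring.
have pk : p ^+ k != 0 by rewrite expf_neq0.
by rewrite -E; field.
Qed.
End SelfReciprocal.

(** No denominator factor that involves a vanishes, whatever the length of the
    sum. *)
Definition regular (F : fieldType) g (a q : F) :=
  forall i l, (i < 2 * g + 2)%N ->
    a_power g a i * q ^+ (2 * g + 3) * (q ^+ (2 * g + 3)) ^+ l != 1.

Lemma coprime_dn_exponents g mu :
  coprime (2 * g + 3) ((2 * g + 3) * mu + g + 2).
Proof.
set d := (2 * g + 3)%N; set n := (_ + 2)%N.
have : coprime d (2 * n).
  have -> : (2 * n = (2 * mu + 1) * d + 1)%N by rewrite /n /d; lia.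
  by rewrite /coprime gcdnMDl gcdn1.
by rewrite coprimeMr => /andP [].
Qed.

Section Vanishing.
Variables (F : fieldType) (g mu : nat) (q : F).
Hypothesis q0 : q != 0.
Hypothesis q_not_root1 : forall m, (0 < m)%N -> q ^+ m != 1.
Let d := (2 * g + 3)%N.
Let n := ((2 * g + 3) * mu + g + 2)%N.
Let N := ((2 * g + 1) * mu + g.+1)%N.
Let p := q ^+ d.

Lemma expq_inj i j : q ^+ i = q ^+ j -> i = j.
Proof.
wlog le_ij : i j / (i <= j)%N.
  by move=> H; case/orP: (leq_total i j) => [/H // | le E]; apply/esym/H.
rewrite -{1}(subnKC le_ij) exprD => /eqP; rewrite -subr_eq0 -{1}[_ ^+ i]mulr1 -mulrBr.
rewrite mulf_eq0 expf_eq0 (negPf q0) andbF /= subr_eq0 eq_sym.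
by case: (posnP (j - i)) => [|/q_not_root1 /negPf-> //]; lia.
Qed.

(** A vanishing factor would be a relation t n = d (l + 1) with t odd and
    0 < t < d, which is excluded since d and n are coprime. *)
Lemma regular_qn : regular g (q ^+ n) q.
Proof.
move=> i l li; rewrite /a_power -!exprM; apply/eqP => E.
have /expq_inj : q ^+ (n * (2 * i) + (d + d * l)) = q ^+ (n * (2 * g).+1).
  apply: (mulIf (invr_neq0 (expf_neq0 (n * (2 * g).+1) q0))).
  rewrite divff ?expf_neq0 // -E.
  by rewrite mulrAC -mulrA -exprD mulrAC -exprD [((2 * g + 3) * l + _)%N]addnC.
move=> {}E.
have : (d %| (2 * g).+1 - 2 * i)%N.
  rewrite -(@Gauss_dvdr d n) ?coprime_dn_exponents //.
  by apply/dvdnP; exists l.+1; rewrite mulnBr -E; lia.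
by move/dvdn_leq; rewrite subn_gt0 /d; nia.
Qed.

Lemma wp_node_inj : injective (wp_node p q^-1).
Proof.
move=> k l /eqP; rewrite -subr_eq0 wp_nodeB ?expf_neq0 // !mulf_eq0 invr_eq0.
rewrite expf_eq0 expf_eq0 (negPf q0) !andbF /= !subr_eq0 => /orP [] /eqP E.
  have /expq_inj : q ^+ (d * k) = q ^+ (d * l).
    by rewrite !exprM -[RHS]mul1r E mulfVK // !expf_neq0.
  by rewrite /d; nia.
have /expq_inj : q ^+ (d * (k + l)) = q ^+ 1.
  by rewrite exprM -[RHS]mulr1 expr1 E mulVKf.
by rewrite /d; nia.
Qed.

Lemma sum_summand_qn_eq0 : \sum_(k < n) summand g (q ^+ n) q k = 0.
Proof.
have p0 : p != 0 by rewrite expf_neq0.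
have reg := regular_qn.
have En : (n * 2 = d * (2 * mu).+1 + 1)%N by rewrite /n /d; lia.
have EN : (d * N = n * (2 * g).+1 + 1)%N by rewrite /n /d /N; lia.
pose z i := a_power g (q ^+ n) i.
have z_first : z 0%N * q^-1 = p ^- N.
  rewrite /z /a_power muln0 expr0 mul1r /p -!exprM EN addn1 exprSr.
  by rewrite invfM mulrC.
have z_last : z (2 * g).+1 * p = q^-1 * p ^+ N.+1.
  apply: (mulIf q0); rewrite mulrAC [RHS]mulrAC mulVf // mul1r exprS mulrC.
  congr (_ * _); rewrite /z /a_power /p -!exprM EN exprD expr1; congr (_ * _).
  apply: (canLR (mulfK _)); first by rewrite expf_neq0.
  by rewrite -exprD; congr (_ ^+ _); lia.
have z_next i : z i.+1 * q^-1 = z i * p * p ^+ (2 * mu).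
  rewrite -mulrA -exprS /z /a_power /p -!exprM.
  apply: (mulIf q0); rewrite mulfVK // -[RHS]mulrA -exprSr mulrAC -exprD.
  by congr (_ ^+ _ / _); lia.
have z_rev (i : 'I_(2 * g).+1) :
    z i * p * (z (rev_ord i) * p) * p ^+ (2 * mu) = q^-1 * p.
  have -> : z i * p * (z (rev_ord i) * p) * p ^+ (2 * mu)
     = z i * z (rev_ord i) * q^-1 * (q * p ^+ (2 * mu).+1) * p.
    by rewrite exprS; field.
  have -> : q * p ^+ (2 * mu).+1 = q ^+ (n * 2).
    by rewrite /p -exprM -exprS En addn1.
  have -> : z i * z (rev_ord i) = q ^- (n * 2).
    have li := ltn_ord i; rewrite /z /a_power mulf_div -!exprM -!exprD.
    have -> : (n * (2 * g).+1 + n * (2 * g).+1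
             = n * 2 + (n * (2 * i) + n * (2 * rev_ord i)))%N.
      by rewrite -!mulnDr /=; congr (_ * _)%N; lia.
    by rewrite [q ^+ (n * 2 + _)]exprD invfM mulrCA mulfV ?mulr1 // expf_neq0.
  by rewrite -mulrA mulrACA mulVf ?expf_neq0 // mul1r.
(* [z_first] and [z_last] take care of the first numerator and of the last
   denominator; the others are matched with a shift of the index by one. *)
pose b (i : 'I_(2 * g).+1) := z i * p.
pose f := node_poly p mu b.
pose C := (1 - q)^-1 * \prod_(i < (2 * g).+1) (qpoch (b i) p (2 * mu))^-1.
have summand_wp k : summand g (q ^+ n) q k =
  C * ((1 - q^-1 * p ^+ (2 * k)) * qpoch q^-1 p k * qpoch (p ^- N) p k
    / (qpoch p p k * qpoch (q^-1 * p ^+ N.+1) p k) * p ^+ (k * N)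
    * f.[wp_node p q^-1 k]).
  have -> : p ^+ (k * N) = p ^+ (g.+1 * k) * p ^+ (k * ((2 * g).+1 * mu)).
    by rewrite -exprD; congr (_ ^+ _); rewrite /N; nia.
  have Ef := prod_qpoch_node p0 z_rev k.
  rewrite /summand -/d -/p.
  have -> : (2 * g + 2 = (2 * g).+2)%N by lia.
  pose L := \prod_(i < (2 * g).+1) qpoch (z i.+1 * q^-1) p k.
  pose D := \prod_(i < (2 * g).+1) qpoch (z i * p) p k.
  have -> : \prod_(i < (2 * g).+2) (qpoch (z i * q^-1) p k / qpoch (z i * p) p k)
          = L / D * (qpoch (p ^- N) p k / qpoch (q^-1 * p ^+ N.+1) p k).
    by rewrite prodf_div big_ord_recl [X in _ / X]big_ord_recr /=
       z_first z_last [RHS]mulf_div [L * _]mulrC.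
  have -> : L / D = p ^+ (k * ((2 * g).+1 * mu)) * f.[wp_node p q^-1 k]
                    * \prod_(i < (2 * g).+1) (qpoch (b i) p (2 * mu))^-1.
    rewrite -Ef -big_split /L /D -prodf_div; apply: eq_bigr => i _.
    rewrite z_next qpoch_shift_ratio // => l.
    by apply: reg; have := ltn_ord i; lia.
  by rewrite /C [(qpoch p p k * _)^-1]invfM; ring.
under eq_bigr do rewrite summand_wp.
(* The 2 mu terms with k > N contain the factor 1 - p^-N p^N. *)
have -> : n = (N.+1 + 2 * mu)%N by rewrite /n /N; lia.
rewrite big_split_ord /= [X in _ + X]big1 ?addr0 => [|k _]; last first.
  rewrite (@qpoch_eq0 _ (p ^- N) _ _ N) ?mulVf ?expf_neq0 //; last lia.
  by rewrite mulr0 !mul0r mulr0.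
have size_f : (size f <= N)%N by rewrite size_node_poly /N; lia.
rewrite -mulr_sumr (wp_sum_eq0 p0 wp_node_inj size_f) ?mulr0 // => k kN.
rewrite -z_last mulf_neq0 // qpoch_neq0 // => i ik.
  by rewrite -exprS -exprM q_not_root1 // /d; lia.
by apply: reg; lia.
Qed.

End Vanishing.

(** * Vanishing at a primitive root of unity *)

(** The factor of index i of (z p^-N; p)_k is - z p^(i-N) times
    1 - p^(N-i) / z, and the latter are the last k factors of (p / z; p)_N. *)
Lemma qpoch_reverse (F : fieldType) (z p : F) N k : z != 0 -> p != 0 -> (k <= N)%N ->
  qpoch (z * p ^- N) p k * qpoch (p / z) p (N - k)
  = (- z) ^+ k * (p ^+ 'C(k, 2) * p ^- (N * k)) * qpoch (p / z) p N.
Proof.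
move=> z0 p0 kN.
have -> : qpoch (p / z) p N
        = qpoch (p / z) p (N - k) * qpoch (p / z * p ^+ (N - k)) p k.
  by rewrite -qpochD subnK.
rewrite [RHS]mulrCA mulrC; congr (_ * _).
have -> : (- z) ^+ k * (p ^+ 'C(k, 2) * p ^- (N * k))
        = \prod_(i < k) (- z * p ^+ i * p ^- N).
  rewrite -bin2_sum !big_split /= !prodr_const !card_ord exprVn -exprM.
  by rewrite mulrA expr_sum big_mkord exprM.
rewrite [qpoch (p / z * _) _ _]qpoch_rev -big_split; apply: eq_bigr => i _ /=.
have -> : p ^+ N = p * p ^+ (N - k) * p ^+ (k - i.+1) * p ^+ i.
  by rewrite -exprS -!exprD; congr (_ ^+ _); have := ltn_ord i; lia.
by field; rewrite !expf_neq0 // p0 z0.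
Qed.

Lemma double_bin2 k : (2 * 'C(k, 2) = k * k.-1)%N.
Proof. by elim: k => // k IH; rewrite binS mulnDr IH bin1; case: k {IH} => //= k; lia. Qed.

Lemma bin2D j k : ('C(j + k, 2) = 'C(j, 2) + 'C(k, 2) + j * k)%N.
Proof.
elim: k => [|k IH]; first by rewrite addn0 muln0 !addn0.
by rewrite addnS !binS IH !bin1; lia.
Qed.

(** Up to the factor (1 - A p^(2k)) / p^k, this is what remains of the k-th
    term once the factors symmetric under k -> N - k are removed. *)
Definition gauss_weight (F : fieldType) (p : F) d h i : F :=
  (-1) ^+ i * p ^+ (d * 'C(i, 2) + h * i).

(** Let w be the weight and c = p^(d k (N - k)).  Then w_k w_(N-k) c = w_N = 1
    because binomials satisfy [bin2D], and w_k w_k c = 1 because the exponent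
    is k times the given period; hence w_k = w_(N-k). *)
Lemma gauss_weight_sym (F : fieldType) (p : F) d h N k : (k <= N)%N -> p != 0 ->
  p ^+ (d * N.-1 + 2 * h) = 1 -> gauss_weight p d h N = 1 ->
  gauss_weight p d h (N - k) = gauss_weight p d h k.
Proof.
move=> kN p0 period wN; set j := (N - k)%N.
have w0 : gauss_weight p d h k != 0 by rewrite mulf_neq0 ?signr_eq0 ?expf_neq0.
apply: (mulIf (x := gauss_weight p d h k * p ^+ (d * k * j))).
  by rewrite mulf_neq0 ?expf_neq0.
transitivity (1 : F).
  rewrite -wN -(subnK kN) -/j /gauss_weight bin2D.
  have -> : (d * ('C(j, 2) + 'C(k, 2) + j * k) + h * (j + k)
    = (d * 'C(j, 2) + h * j) + ((d * 'C(k, 2) + h * k) + d * k * j))%N by lia.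
  rewrite [p ^+ (_ + (_ + _))]exprD [p ^+ (_ + d * k * j)]exprD.
  by rewrite [_ ^+ (j + k)]exprD; ring.
transitivity (p ^+ ((d * 'C(k, 2) + h * k) * 2 + d * k * j)).
  have -> : ((d * 'C(k, 2) + h * k) * 2 + d * k * j
           = (d * N.-1 + 2 * h) * k)%N.
    have := double_bin2 k; rewrite /j => E.
    have -> : ((d * 'C(k, 2) + h * k) * 2 = d * (2 * 'C(k, 2)) + 2 * h * k)%N by lia.
    rewrite E; case: k kN {j w0 E} => [|k] kN; first by lia.
    have -> : N = (k + (N - k.+1)).+1 by lia.
    by rewrite subSS addKn /=; lia.
  by rewrite exprM period expr1n.
rewrite exprD [p ^+ (_ * 2)]exprM expr2 -mulrA -[LHS](signrMK k) /gauss_weight.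
ring.
Qed.

Section RootOfUnity.
Variables (F : fieldType) (g mu : nat) (q : F).
Let d := (2 * g + 3)%N.
Let n := ((2 * g + 3) * mu + g + 2)%N.
Let N := ((2 * g + 1) * mu + g.+1)%N.
Hypothesis q_prim : n.-primitive_root q.
Let p := q ^+ d.

Lemma prim_root_neq0 : q != 0.
Proof.
apply: contra_eq_neq (prim_expr_order q_prim) => ->.
by rewrite expr0n /n addn2 /= eq_sym oner_eq0.
Qed.

Lemma expp_n : p ^+ n = 1.
Proof. by rewrite exprAC (prim_expr_order q_prim) expr1n. Qed.

Lemma period_exponent : (d * N.-1 + 2 * g.+1 = n * (2 * g).+1)%N.
Proof.
have -> : N.-1 = ((2 * g + 1) * mu + g)%N by rewrite /N; lia.
by rewrite /d /n; lia.
Qed.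

(** Twice the exponent of p is n (2g + 1) N.  If n is odd then N is even and
    the exponent is a multiple of n.  If n is even then N is odd, and the
    sign (-1)^N cancels against an odd power of q^(n/2) = -1. *)
Lemma gauss_weight_N : gauss_weight p d g.+1 N = 1.
Proof.
have E : (2 * (d * 'C(N, 2) + g.+1 * N) = n * ((2 * g).+1 * N))%N.
  rewrite [RHS]mulnA -period_exponent mulnDr [(2 * (d * _))%N]mulnCA double_bin2.
  by lia.
have oddN : odd N = ~~ odd n by rewrite /N /n; lia.
rewrite /gauss_weight; move: E; set e := (_ + _)%N; move: e => e E.
case: (boolP (odd n)) => on.
  have oN : ~~ odd N by rewrite oddN on.
  rewrite -signr_odd (negPf oN) mul1r.
  have -> : e = (n * ((2 * g).+1 * N./2))%N.
    apply/eqP; rewrite -(eqn_pmul2l (isT : 0 < 2)%N) E.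
    by rewrite -{1}(odd_double_half N) (negPf oN) add0n -mul2n; apply/eqP; lia.
  by rewrite exprM expp_n expr1n.
have oN : odd N by rewrite oddN on.
have En : n = (2 * n./2)%N by lia.
have half : q ^+ n./2 = -1.
  have : (q ^+ n./2) ^+ 2 == 1 by rewrite -exprM mulnC -En prim_expr_order.
  rewrite sqrf_eq1 => /orP [|/eqP //].
  rewrite -(prim_order_dvd q_prim) => /dvdn_leq.
  by rewrite /n; lia.
rewrite -signr_odd oN expr1 /p -exprM.
have -> : (d * e = n./2 * (d * ((2 * g).+1 * N)))%N.
  apply/eqP; rewrite -(eqn_pmul2l (isT : 0 < 2)%N) mulnCA E {1}En.
  by apply/eqP; lia.
by rewrite exprM half -signr_odd !oddM oN /= /d oddD !oddM /= mulNr mul1r opprK.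
Qed.

Lemma expp_N : p ^+ N = q.
Proof.
rewrite -exprM; have -> : (d * N = n * (2 * g).+1 + 1)%N by rewrite /n /d /N; lia.
by rewrite exprD exprM (prim_expr_order q_prim) expr1n mul1r.
Qed.

Lemma base_not_root1 i : (i.+1 < n)%N -> p * p ^+ i != 1.
Proof.
move=> i_n; rewrite -exprS -exprM -(prim_order_dvd q_prim) Gauss_dvdr; last first.
  by rewrite coprime_sym coprime_dn_exponents.
by apply/negP => /(dvdn_leq (ltn0Sn i)); rewrite leqNgt i_n.
Qed.

Variable a : F.
Hypotheses (a0 : a != 0) (reg : regular g a q).

Lemma a_power_prod1 : \prod_(i < 2 * g + 2) a_power g a i = 1.
Proof.
have := prod_apos_aneg g 1 id a0; under [RHS]eq_bigr do rewrite mulr1.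
move=> <-; rewrite /apos /aneg !big_map -big_split big1_seq //= => j _.
by rewrite !mulr1 mulfV // expf_neq0.
Qed.

Lemma prod_qpoch_a_power (c : F) m :
  \prod_(i < 2 * g + 2) qpoch (c / a_power g a i) p m
  = \prod_(i < 2 * g + 2) qpoch (a_power g a i * c) p m.
Proof.
rewrite (reindex_inj rev_ord_inj); apply: eq_bigr => i _.
by rewrite -a_powerV // a_power_inv invrK mulrC.
Qed.

(** [qpoch_reverse] applied to every power z of a: the factors (-z)^k
    disappear because the product of the z is 1 and their number is even. *)
Lemma prod_qpoch_ratio k : (k <= N)%N ->
  \prod_(i < 2 * g + 2)
     (qpoch (a_power g a i * q^-1) p k / qpoch (a_power g a i * p) p k)
  = (p ^+ 'C(k, 2) * p ^- (N * k)) ^+ (2 * g + 2)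
    * (\prod_(i < 2 * g + 2) qpoch (a_power g a i * p) p N
     / (\prod_(i < 2 * g + 2) qpoch (a_power g a i * p) p k
        * \prod_(i < 2 * g + 2) qpoch (a_power g a i * p) p (N - k))).
Proof.
move=> kN; set u := _ * p ^- _.
have q0 := prim_root_neq0; have p0 : p != 0 by rewrite expf_neq0.
have z0 i : a_power g a i != 0 by rewrite mulf_neq0 ?invr_neq0 ?expf_neq0.
set D := fun m => \prod_(i < 2 * g + 2) qpoch (a_power g a i * p) p m.
have D0 m : D m != 0.
  apply/prodf_neq0 => i _; apply: qpoch_neq0 => l _; exact: reg.
have E : \prod_(i < 2 * g + 2) qpoch (a_power g a i * q^-1) p k * D (N - k)%N
       = u ^+ (2 * g + 2) * D N.
  rewrite /D -!(prod_qpoch_a_power p) -big_split /= -expp_N.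
  under eq_bigr do rewrite qpoch_reverse // -/u.
  rewrite !big_split /= !prodr_const !card_ord; congr (_ * _).
  rewrite prodrXl prodrN a_power_prod1 card_ord.
  by rewrite -signr_odd oddD oddM /= expr0 mulr1 expr1n mul1r -exprMn.
rewrite prodf_div -[X in X / _](mulfK (D0 (N - k)%N)) E /D.
by field; rewrite !D0.
Qed.

(** By reversal the term is (1 - A p^(2k)) times [gauss_weight], divided by
    p^k, times factors symmetric under k -> N - k.  As A = p^-N, the first
    factor divided by p^k is p^-N (p^(N-k) - p^k), which is antisymmetric. *)
Lemma summand_antisym k : (k <= N)%N ->
  summand g a q (N - k) = - summand g a q k.
Proof.
move=> kN; have q0 := prim_root_neq0.
have p0 : p != 0 by rewrite expf_neq0.
have P0 m : (m <= N)%N -> qpoch p p m != 0.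
  move=> mN; apply: qpoch_neq0 => i im; apply: base_not_root1.
  by apply: (leq_ltn_trans (leq_trans im mN)); rewrite /N /n; lia.
have base_ratio j : (j <= N)%N -> qpoch q^-1 p j / qpoch p p j
   = (-1) ^+ j * (p ^+ 'C(j, 2) * p ^- (N * j)) * (qpoch p p N / (qpoch p p j * qpoch p p (N - j))).
  move=> jN; have := qpoch_reverse (oner_neq0 _) p0 jN.
  rewrite mul1r divr1 expp_N => E.
  have Pj := P0 _ jN; have PNj := P0 _ (leq_subr j N).
  apply: (mulIf PNj); rewrite mulrAC E; field.
  by rewrite Pj PNj expf_neq0.
pose w := gauss_weight p d g.+1.
pose S j := qpoch p p N / (qpoch p p j * qpoch p p (N - j))
  * (\prod_(i < 2 * g + 2) qpoch (a_power g a i * p) p N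
     / (\prod_(i < 2 * g + 2) qpoch (a_power g a i * p) p j
        * \prod_(i < 2 * g + 2) qpoch (a_power g a i * p) p (N - j))).
have S_sym : S (N - k)%N = S k.
  by rewrite /S subKn // [qpoch p p (N - k) * _]mulrC [\prod_(i < _) qpoch _ p (N - k) * _]mulrC.
have summandS j : (j <= N)%N ->
    summand g a q j = (p ^+ (N - j) - p ^+ j) * (w j * S j / (p ^+ N * (1 - q))).
  move=> jN; rewrite /summand -/d -/p prod_qpoch_ratio // base_ratio // /S.
  have -> : p ^+ (N - j) = p ^+ N * p ^- j.
    by apply: (canRL (mulfK _)); rewrite ?expf_neq0 // -exprD subnK.
  have -> : w j = (-1) ^+ j * (p ^+ (d * 'C(j, 2)) * p ^+ (g.+1 * j)).
    by rewrite -exprD.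
  set u := p ^+ 'C(j, 2) * p ^- (N * j).
  have u_d : p ^+ (d * 'C(j, 2)) = u ^+ (2 * g + 2) * u * p ^+ j.
    have -> : u ^+ (2 * g + 2) * u = u ^+ d by rewrite -exprSr -addnS.
    rewrite exprMn -[p ^+ 'C(j, 2) ^+ d]exprM mulnC -mulrA.
    suff -> : p ^- (N * j) ^+ d * p ^+ j = 1 by rewrite mulr1.
    rewrite exprVn [p ^+ (N * j)]exprM expp_N -[q ^+ j ^+ d]exprM mulnC.
    by rewrite [q ^+ (d * j)]exprM mulVf // expf_neq0.
  rewrite u_d mul2n -addnn [p ^+ (j + j)]exprD expp_N; move: (p ^+ j) (expf_neq0 j p0) => x x0.
  rewrite [X in _ = _ * (_ / X)]mulrC.
  move: (_ / (_ * _)) (_ / (_ * _)) => R R'.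
  rewrite invfM; move: (1 - q)^-1 (p ^+ _) ((-1) ^+ j) (u ^+ _) => r y s v.
  by clear -x0 q0; clearbody u; field; rewrite x0 q0.
rewrite !summandS ?leq_subr // subKn // S_sym.
have -> : w (N - k)%N = w k.
  apply: gauss_weight_sym gauss_weight_N => //.
  by rewrite period_exponent exprM expp_n expr1n.
by rewrite -mulNr opprB.
Qed.

Hypothesis two_neq0 : 2%:R != 0 :> F.

Lemma sum_summand_root_eq0 : \sum_(k < n) summand g a q k = 0.
Proof.
have q0 := prim_root_neq0.
have -> : n = (N.+1 + 2 * mu)%N by rewrite /n /N; lia.
rewrite big_split_ord /= [X in _ + X]big1 ?addr0 => [|k _]; last first.
  rewrite /summand -/d -/p [qpoch q^-1 _ _](@qpoch_eq0 _ _ _ _ N); last 2 first.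
  - by lia.
  - by rewrite expp_N mulVf.
  by rewrite mul0r !mulr0 mul0r.
apply/eqP; set S := \sum_(_ < _) _.
suff : S *+ 2 == 0 by rewrite -mulr_natl mulf_eq0 (negPf two_neq0).
rewrite mulr2n {2}/S (reindex_inj rev_ord_inj) -big_split big1 //= => k _.
by rewrite subSS summand_antisym ?addrN // -ltnS.
Qed.
End RootOfUnity.

Lemma regularV (F : fieldType) g (a q : F) : a != 0 ->
  regular g a q -> regular g a^-1 q.
Proof.
by move=> a0 reg i l li; rewrite (a_powerV (Ordinal li)) //; apply: reg.
Qed.

(** * Localization and specialization *)

Section Specialization.
Variables (R : idomainType) (K : fieldType) (I : Type).
Variables (phi : I -> {rmorphism R -> K}) (i0 : I).
Local Notation L := (@FracField.tofrac R).

(** A belongs to the localization of R at the elements that none of the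
    morphisms kills, and v lists its images.  One fraction has to serve for all
    morphisms: its denominator must be prime to a product of several primes. *)
Definition specializes (A : {fraction R}) (v : I -> K) :=
  exists X W : R, [/\ forall i, phi i W != 0, A = L X / L W
                    & forall i, phi i X = v i * phi i W].

Let frac_neq0 W : (forall i, phi i W != 0) -> L W != 0.
Proof.
by move/(_ i0) => H; rewrite tofrac_eq0; apply: contraNneq H => ->; rewrite rmorph0.
Qed.

Lemma specializes_tofrac x : specializes (L x) (fun i => phi i x).
Proof.
exists x, 1; split=> [i||i]; rewrite ?rmorph1 ?oner_eq0 ?mulr1 //.
by rewrite divr1.
Qed.

Lemma specializes1 : specializes 1 (fun=> 1).
Proof. by exists 1, 1; split=> [i||i]; rewrite ?rmorph1 ?oner_eq0 ?mulr1 ?divr1. Qed.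

Lemma specializesD A B v w : specializes A v -> specializes B w ->
  specializes (A + B) (fun i => v i + w i).
Proof.
move=> [X [W [W0 -> vE]]] [Y [Z [Z0 -> wE]]]; exists (X * Z + Y * W), (W * Z).
split=> [i||i]; first by rewrite rmorphM mulf_neq0.
  by rewrite addf_div ?frac_neq0 // !(rmorphD, rmorphM).
by rewrite !(rmorphD, rmorphM) /= vE wE; ring.
Qed.

Lemma specializesN A v : specializes A v -> specializes (- A) (fun i => - v i).
Proof.
move=> [X [W [W0 -> vE]]]; exists (- X), W; split=> // [|i].
  by rewrite rmorphN mulNr.
by rewrite rmorphN vE mulNr.
Qed.

Lemma specializesM A B v w : specializes A v -> specializes B w ->
  specializes (A * B) (fun i => v i * w i).
Proof.
move=> [X [W [W0 -> vE]]] [Y [Z [Z0 -> wE]]]; exists (X * Y), (W * Z).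
split=> [i||i]; first by rewrite rmorphM mulf_neq0.
  by rewrite mulf_div !rmorphM.
by rewrite !rmorphM vE wE mulrACA.
Qed.

Lemma specializesV A v : (forall i, v i != 0) -> specializes A v ->
  specializes A^-1 (fun i => (v i)^-1).
Proof.
move=> v0 [X [W [W0 -> vE]]]; exists W, X; split=> [i||i].
- by rewrite vE mulf_neq0.
- by rewrite invf_div.
- by rewrite vE mulKf.
Qed.

Lemma specializesX A v m : specializes A v ->
  specializes (A ^+ m) (fun i => v i ^+ m).
Proof.
move=> Av; elim: m => [|m IH]; first exact: specializes1.
have [X [W [W0 E vE]]] := specializesM Av IH; exists X, W; split=> // [|i].
  by rewrite exprS.
by rewrite vE exprS.
Qed.

Lemma specializes_prod m (A : nat -> {fraction R}) v :
  (forall j, (j < m)%N -> specializes (A j) (v j)) ->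
  specializes (\prod_(j < m) A j) (fun i => \prod_(j < m) v j i).
Proof.
elim: m => [|m IH] H.
  have [X [W [W0 E vE]]] := specializes1; exists X, W; split=> // [|i].
    by rewrite big_ord0.
  by rewrite big_ord0.
have [X [W [W0 E vE]]] := specializesM (IH (fun j jm => H j (ltnW jm))) (H m (ltnSn m)).
by exists X, W; split=> // [|i]; rewrite big_ord_recr.
Qed.

Lemma specializes_sum m (A : nat -> {fraction R}) v :
  (forall j, (j < m)%N -> specializes (A j) (v j)) ->
  specializes (\sum_(j < m) A j) (fun i => \sum_(j < m) v j i).
Proof.
elim: m => [|m IH] H.
  exists 0, 1; split=> [i||i]; first by rewrite rmorph1 oner_eq0.
    by rewrite big_ord0 rmorph0 mul0r.
  by rewrite big_ord0 rmorph0 mul0r.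
have [X [W [W0 E vE]]] := specializesD (IH (fun j jm => H j (ltnW jm))) (H m (ltnSn m)).
by exists X, W; split=> // [|i]; rewrite big_ord_recr.
Qed.

Lemma specializes_1subM A B v w : specializes A v -> specializes B w ->
  specializes (1 - A * B) (fun i => 1 - v i * w i).
Proof.
by move=> sA sB; apply: specializesD specializes1 (specializesN (specializesM sA sB)).
Qed.

Lemma specializes_qpoch x q vx vq k : specializes x vx -> specializes q vq ->
  specializes (qpoch x q k) (fun i => qpoch (vx i) (vq i) k).
Proof.
move=> sx sq; apply: (specializes_prod (A := fun j => 1 - x * q ^+ j)
  (v := fun j i => 1 - vx i * vq i ^+ j)) => j _.
exact: specializes_1subM sx (specializesX _ sq).
Qed.

Lemma specializes_summand g a q va vq k :
  specializes a va -> specializes q vq ->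
  (forall i, [/\ va i != 0, vq i != 0 & vq i != 1]) ->
  (forall i, regular g (va i) (vq i)) ->
  (forall i l, (l < k)%N -> vq i ^+ (2 * g + 3) * vq i ^+ (2 * g + 3) ^+ l != 1) ->
  specializes (summand g a q k) (fun i => summand g (va i) (vq i) k).
Proof.
move=> sa sq nz reg base.
have va0 i : va i != 0 by have [] := nz i.
have vq0 i : vq i != 0 by have [] := nz i.
have sqV : specializes q^-1 (fun i => (vq i)^-1) := specializesV vq0 sq.
have sp := specializesX (2 * g + 3) sq.
have sz j : specializes (a_power g a j) (fun i => a_power g (va i) j).
  apply: specializesM (specializesX _ sa) (specializesV _ (specializesX _ sa)).
  by move=> i; rewrite expf_neq0.
apply: specializesM; last exact: specializesX sp.
apply: specializesM.
  apply: specializesM; first exact: specializes_1subM sqV (specializesX _ sp).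
  apply: specializesV; last first.
    exact: specializesD specializes1 (specializesN sq).
  by move=> i; rewrite subr_eq0 eq_sym; have [] := nz i.
apply: specializesM.
  apply: (specializes_prod (A := fun j => qpoch (a_power g a j * q^-1) _ k
       / qpoch (a_power g a j * _) _ k)
     (v := fun j i => qpoch (a_power g (va i) j * (vq i)^-1) _ k
       / qpoch (a_power g (va i) j * _) _ k)) => j jg.
  apply: specializesM; first by apply: specializes_qpoch (sp); apply: specializesM (sqV).
  apply: specializesV; last by apply: specializes_qpoch (sp); apply: specializesM (sp).
  by move=> i; apply: qpoch_neq0 => l _; apply: reg.
apply: specializesM; first exact: specializes_qpoch sqV sp.
apply: specializesV; last exact: (specializes_qpoch k sp sp).
by move=> i; apply: qpoch_neq0 => l lk; apply: base.
Qed.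
End Specialization.

Section PrimeOfMorphism.
Variables (R : idomainType) (K : idomainType) (phi : {rmorphism R -> K}) (pi : R).
Hypothesis phi_ker : forall x, phi x = 0 -> divides pi x.

(** If X = P Y then phi Y = 0, so pi divides Y: divisibility by a product is
    obtained one prime at a time, without unique factorization. *)
Lemma divides_mul_kernel P X :
  divides P X -> phi P != 0 -> phi X = 0 -> divides (P * pi) X.
Proof.
move=> [Y ->] P0 /eqP; rewrite rmorphM mulf_eq0 (negPf P0) /= => /eqP.
by move/phi_ker => [Z ->]; exists Z; rewrite mulrA.
Qed.

(** Let D T = P pi with D dividing W.  Then phi D is nonzero, so phi T = 0 and
    pi divides T; cancelling pi shows that D divides P already. *)
Lemma relprime_mul_kernel W P : pi != 0 -> phi pi = 0 ->
  phi W != 0 -> relprime W P -> relprime W (P * pi).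
Proof.
move=> pi0 phi_pi W0 WP D [S WE] [T PE]; apply: (WP) => //; first by exists S.
have : phi (D * T) == 0 by rewrite -PE rmorphM phi_pi mulr0.
rewrite rmorphM mulf_eq0; case/orP => [D0|/eqP/phi_ker [T' TE]].
  by move: W0; rewrite WE rmorphM (eqP D0) mul0r eqxx.
by exists T'; apply: (mulIf pi0); rewrite PE TE; ring.
Qed.
End PrimeOfMorphism.

Lemma relprime1 (R : comUnitRingType) (W : R) : relprime W 1.
Proof. by move=> D _ [S E]; apply/unitrPr; exists S. Qed.

(** * The three places *)

Section KernelAtInverse.
Variables (R : idomainType) (K : fieldType) (j : {rmorphism R -> K}) (c : R).
Hypotheses (j_inj : injective j) (c0 : c != 0).

(** Although 1 - c X is not monic, no denominators appear: the quotient is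
    the power series x / (1 - c X), whose coefficients S_k satisfy
    S_(k+1) = c S_k + x_(k+1), and the root condition says that S_k = 0 at
    k = deg x, hence from there on. *)
Lemma divides_root_inverse (x : {poly R}) :
  (map_poly j x).[(j c)^-1] = 0 -> divides (1 - 'X * c%:P) x.
Proof.
pose S k := \sum_(i < k.+1) x`_i * c ^+ (k - i).
have jc0 : j c != 0 by rewrite -(rmorph0 j) (inj_eq j_inj).
have SS k : S k.+1 = c * S k + x`_k.+1.
  rewrite /S big_ord_recr /= subnn expr0 mulr1; congr (_ + _).
  rewrite mulr_sumr; apply: eq_bigr => i _ /=.
  have ik : (i <= k)%N by have := ltn_ord i; rewrite ltnS.
  by rewrite subSn // exprS mulrCA.
rewrite horner_coef size_map_inj_poly ?rmorph0 // => root_x.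
have S_last k : size x = k.+1 -> S k = 0.
  move=> sx; apply: j_inj; rewrite rmorph0 rmorph_sum -[RHS](mulr0 (j c ^+ k)).
  rewrite -[X in _ = _ * X]root_x sx mulr_sumr; apply: eq_bigr => i _.
  have ik : (i <= k)%N by have := ltn_ord i; rewrite ltnS.
  rewrite coef_map rmorphM rmorphXn mulrCA; congr (_ * _).
  have -> : j c ^+ k = j c ^+ (k - i) * j c ^+ i by rewrite -exprD subnK.
  by rewrite -mulrA exprVn mulfV ?mulr1 // expf_neq0.
exists (\poly_(k < size x) S k); apply/polyP => k.
rewrite mulrBl mul1r -mulrA coefB coefXM coefCM !coef_poly.
case: k => [|k] /=.
  rewrite subr0; case: ifP => [_|/negbT]; last by rewrite -leqNgt => /leq_sizeP ->.
  by rewrite /S big_ord1 subn0 expr0 mulr1.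
case: (ltngtP k.+1 (size x)) => [lt|gt|/esym sx].
- by rewrite SS addrC addKr.
- by rewrite mulr0 subr0 nth_default // ltnW.
- by rewrite S_last // mulr0 subr0 nth_default // sx.
Qed.
End KernelAtInverse.

Lemma divides_XsubC (R : idomainType) (c : R) (x : {poly R}) :
  x.[c] = 0 -> divides ('X - c%:P) x.
Proof. by move=> /eqP /factor_theorem [y ->]; exists y; rewrite mulrC. Qed.

Definition fracC : fieldType := {fraction {poly algC}}.
Local Notation L := (@FracField.tofrac {poly algC}).

Definition polyQC : {rmorphism {poly rat} -> {poly algC}} := map_poly ratr.

Definition at_root (z : algC) : {rmorphism polyaq -> fracC} :=
  L \o map_poly (horner_eval z \o polyQC).
Definition at_power (n : nat) : {rmorphism polyaq -> fracC} :=
  L \o (polyQC \o horner_eval 'X^n).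
Definition at_inv_power (n : nat) : {rmorphism polyaq -> fracC} :=
  horner_eval ((L 'X)^-1 ^+ n) \o map_poly (L \o polyQC).

Lemma polyQC_inj : injective polyQC.
Proof. by apply: map_inj_poly; [exact: fmorph_inj | rewrite rmorph0]. Qed.

(** The kernel consists of the polynomials all of whose coefficients, which
    lie in Q[q], vanish at z; the cyclotomic polynomial is the minimal
    polynomial of z over Q. *)
Lemma divides_at_root n z x : n.-primitive_root z ->
  at_root z x = 0 -> divides (Phiq n) x.
Proof.
move=> z_prim /eqP; rewrite [at_root z x]/= tofrac_eq0 => /eqP x0.
set P := map_poly (intr : int -> rat) 'Phi_n.
have P_dvd (r : {poly rat}) : (polyQC r).[z] = 0 -> P %| r.
  have [m [mE _ m_dvd]] := minCpolyP z.
  suff -> : P = m by move=> /eqP; rewrite -m_dvd.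
  apply: polyQC_inj; rewrite -[RHS]mE -[LHS]/(map_poly ratr P) (minCpoly_cyclotomic z_prim).
  rewrite -(Cintr_Cyclotomic z_prim) /P -map_poly_comp.
  by apply: eq_map_poly => b; rewrite /= ratr_int.
exists (\poly_(i < size x) (x`_i %/ P)); apply/polyP => i.
rewrite coefCM coef_poly; case: ifP => [_|/negbT]; last first.
  by rewrite -leqNgt => /leq_sizeP ->; rewrite ?mulr0.
rewrite mulrC divpK // P_dvd //.
by have := congr1 (fun p : {poly algC} => p`_i) x0; rewrite coef_map coef0.
Qed.

Lemma divides_at_power n x : at_power n x = 0 -> divides (pa - pq ^+ n) x.
Proof.
move/eqP; rewrite [at_power n x]/= tofrac_eq0 => /eqP.
rewrite -(rmorph0 polyQC) => /polyQC_inj H.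
by rewrite /pq -rmorphXn; apply: divides_XsubC.
Qed.

Lemma divides_at_inv_power n x : at_inv_power n x = 0 ->
  divides (1 - pa * pq ^+ n) x.
Proof.
move=> H; rewrite /pq -rmorphXn.
apply: (@divides_root_inverse _ _ (L \o polyQC)).
- move=> u v /eqP; rewrite /= tofrac_eq => /eqP; exact: polyQC_inj.
- by rewrite -size_poly_eq0 size_polyXn.
- by rewrite !rmorphXn /= map_polyX -exprVn.
Qed.

Lemma Cyclotomic_rat_neq0 n : map_poly (intr : int -> rat) 'Phi_n != 0.
Proof.
rewrite -size_poly_eq0 size_map_inj_poly ?rmorph0 //; last exact: intr_inj.
by rewrite size_poly_eq0 monic_neq0 // Cyclotomic_monic.
Qed.

Inductive place := AtRoot | AtInvPower | AtPower.

Section Places.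
Variables (g mu : nat) (z : algC).
Let n := ((2 * g + 3) * mu + g + 2)%N.
Hypothesis z_prim : n.-primitive_root z.

Definition at_place (i : place) : {rmorphism polyaq -> fracC} :=
  match i with
  | AtRoot => at_root z
  | AtInvPower => at_inv_power n
  | AtPower => at_power n
  end.

Let X : fracC := L 'X.

Definition place_a (i : place) : fracC :=
  match i with AtRoot => X | AtInvPower => (X ^+ n)^-1 | AtPower => X ^+ n end.
Definition place_q (i : place) : fracC :=
  match i with AtRoot => L z%:P | _ => X end.

Lemma at_place_a i : at_place i pa = place_a i.
Proof.
case: i; rewrite /= ?map_polyX //; first by rewrite /horner_eval hornerX exprVn.
by rewrite /horner_eval hornerX rmorphXn /= map_polyX rmorphXn.
Qed.

Lemma at_place_q i : at_place i pq = place_q i.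
Proof.
case: i; rewrite /= /pq ?map_polyC /horner_eval ?hornerC /= map_polyX //.
by rewrite /horner_eval hornerX.
Qed.

Lemma X_neq0 : X != 0.
Proof. by rewrite tofrac_eq0 polyX_eq0. Qed.

Lemma X_not_root1 m : (0 < m)%N -> X ^+ m != 1.
Proof.
move=> m0; rewrite -rmorphXn -(rmorph1 L) /= tofrac_eq.
apply/eqP => /(congr1 (fun p : {poly algC} => size p)).
by rewrite size_polyXn size_poly1; case: m m0.
Qed.

(** At the root of unity a is transcendental over the constants, so an odd
    power of a times a constant is never 1. *)
Lemma regular_place i : regular g (place_a i) (place_q i).
Proof.
case: i => /=; last exact: regular_qn X_neq0 X_not_root1.
  move=> i l _; rewrite -mulrA -exprS -exprM -!rmorphXn /=.
  set c := z ^+ _; apply/eqP => E.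
  have {E} : X ^+ (2 * i) * L c%:P = X ^+ (2 * g).+1.
    rewrite -[RHS]mul1r -[X in _ = X * _]E /a_power mulrAC mulfVK //.
    by rewrite expf_neq0 ?X_neq0.
  rewrite -!rmorphXn -rmorphM /= => /eqP; rewrite tofrac_eq => /eqP.
  move/(congr1 (fun p : {poly algC} => p`_(2 * g).+1)) => /eqP.
  rewrite coefMC !coefXn eqxx; have -> : ((2 * g).+1 == 2 * i)%N = false by lia.
  by rewrite mul0r eq_sym oner_eq0.
by apply: regularV; rewrite ?expf_neq0 ?X_neq0 //; apply: regular_qn X_neq0 X_not_root1.
Qed.

Lemma n_gt1 : (1 < n)%N. Proof. by rewrite /n; lia. Qed.

Lemma place_q_neq1 i : place_q i != 1.
Proof.
have X1 : X != 1 by rewrite -[X]expr1 X_not_root1.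
case: i; [|exact: X1|exact: X1].
rewrite /place_q -tofrac1 tofrac_eq -polyC1 (inj_eq (@polyC_inj _)).
by rewrite -[z]expr1 -(prim_order_dvd z_prim) dvdn1 neq_ltn n_gt1 orbT.
Qed.

Lemma place_nz i : [/\ place_a i != 0, place_q i != 0 & place_q i != 1].
Proof.
split; last exact: place_q_neq1.
  case: i; [exact: X_neq0 | | exact: expf_neq0 X_neq0].
  exact: invr_neq0 (expf_neq0 n X_neq0).
case: i; [|exact: X_neq0|exact: X_neq0].
rewrite /place_q tofrac_eq0 polyC_eq0; exact: prim_root_neq0 z_prim.
Qed.

Lemma root_prim : n.-primitive_root (L z%:P).
Proof.
have inj : injective (L \o polyC : {rmorphism algC -> fracC}) := @fmorph_inj _ _ _.
by rewrite (fmorph_primitive_root (L \o polyC)).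
Qed.

Lemma place_base i l : (l.+1 < n)%N ->
  place_q i ^+ (2 * g + 3) * place_q i ^+ (2 * g + 3) ^+ l != 1.
Proof.
move=> ln; have gen : X ^+ (2 * g + 3) * X ^+ (2 * g + 3) ^+ l != 1.
  by rewrite -exprS -exprM X_not_root1 // addn3.
have gen0 := base_not_root1 root_prim ln.
by case: i; [exact: gen0 | exact: gen | exact: gen].
Qed.

Lemma sum_summand_place i : \sum_(k < n) summand g (place_a i) (place_q i) k = 0.
Proof.
have nz2 : 2%:R != 0 :> fracC.
  by rewrite -(rmorph_nat L) tofrac_eq0 -polyC_natr polyC_eq0 Num.Theory.pnatr_eq0.
case: i (regular_place i) => reg; rewrite /place_a /place_q.
- have S0 := sum_summand_root_eq0 root_prim X_neq0 reg nz2; exact: S0.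
- under eq_bigr do rewrite summandV ?expf_neq0 ?X_neq0 //.
  exact: sum_summand_qn_eq0 X_neq0 X_not_root1.
- exact: sum_summand_qn_eq0 X_neq0 X_not_root1.
Qed.

Definition place_factor (i : place) : polyaq :=
  match i with
  | AtRoot => Phiq n
  | AtInvPower => 1 - pa * pq ^+ n
  | AtPower => pa - pq ^+ n
  end.

Lemma divides_place_factor i x : at_place i x = 0 -> divides (place_factor i) x.
Proof.
case: i; first exact: divides_at_root z_prim.
  exact: divides_at_inv_power.
exact: divides_at_power.
Qed.

Lemma place_factor_eq0 i : at_place i (place_factor i) = 0.
Proof.
case: i; rewrite /place_factor.
- rewrite [LHS]/= map_polyC /= /horner_eval -map_poly_comp.
  rewrite (eq_map_poly (ratr_int _)) (Cintr_Cyclotomic z_prim).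
  have /rootP -> : root (cyclotomic z n) z by rewrite root_cyclotomic.
  by rewrite polyC0 rmorph0.
- rewrite rmorphB rmorph1 rmorphM rmorphXn at_place_a at_place_q /place_a /place_q.
  by rewrite mulVf ?subrr // expf_neq0 // X_neq0.
- by rewrite rmorphB rmorphXn at_place_a at_place_q /place_a /place_q subrr.
Qed.

Lemma Phiq_place_neq0 i : i <> AtRoot -> at_place i (Phiq n) != 0.
Proof.
have PhiL : L (polyQC (map_poly (intr : int -> rat) 'Phi_n)) != 0.
  by rewrite tofrac_eq0 -(rmorph0 polyQC) (inj_eq polyQC_inj) Cyclotomic_rat_neq0.
have at_inv (r : {poly rat}) : at_inv_power n r%:P = L (polyQC r).
  by rewrite /= map_polyC /horner_eval hornerC.
have at_pow (r : {poly rat}) : at_power n r%:P = L (polyQC r).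
  by rewrite /= /horner_eval hornerC.
case: i => [neq|_|_]; first by case: neq.
  by rewrite /at_place /Phiq at_inv.
by rewrite /at_place /Phiq at_pow.
Qed.

Lemma inv_factor_at_power_neq0 : at_place AtPower (place_factor AtInvPower) != 0.
Proof.
rewrite /place_factor rmorphB rmorph1 rmorphM rmorphXn at_place_a at_place_q.
rewrite /place_a /place_q subr_eq0 eq_sym -exprD X_not_root1 //.
by have := n_gt1; case: n.
Qed.

Lemma place_factor_neq0 i : place_factor i != 0.
Proof.
case: i.
- have Phi0 : at_place AtPower (Phiq n) != 0 by apply: Phiq_place_neq0.
  by apply: contraNneq Phi0 => E; rewrite -[Phiq n]/(place_factor AtRoot) E rmorph0.
- by apply: contraNneq inv_factor_at_power_neq0 => ->; rewrite rmorph0.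
- by rewrite /place_factor /pq -rmorphXn polyXsubC_eq0.
Qed.

Lemma specializes_sum_summand :
  specializes at_place (\sum_(k < n) summand g fa fq k) (fun=> 0).
Proof.
have sa : specializes at_place fa place_a.
  have [x [w [w0 E vE]]] := specializes_tofrac at_place pa.
  by exists x, w; split=> // i; rewrite vE at_place_a.
have sq : specializes at_place fq place_q.
  have [x [w [w0 E vE]]] := specializes_tofrac at_place pq.
  by exists x, w; split=> // i; rewrite vE at_place_q.
have sk k : (k < n)%N -> specializes at_place (summand g fa fq k)
    ((fun k i => summand g (place_a i) (place_q i) k) k).
  move=> kn; apply: (specializes_summand AtRoot sa sq place_nz regular_place) => i l lk.
  by apply: place_base; apply: leq_ltn_trans lk kn.
have [x [w [w0 E vE]]] := specializes_sum AtRoot sk.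
by exists x, w; split=> // i; rewrite vE sum_summand_place.
Qed.

End Places.

Theorem theorem8 (d n : nat) (hd3 : (3 <= d)%N) (hdodd : odd d)
    (hn0 : (0 < n)%N) (hn : (2 * n = 1 %[mod d])%N) :
  congr0
    (\sum_(0 <= k < n)
        qint fq ((2 * d * k)%N%:Z - 1)
        * ((qpochs (apos d fa fq^-1) (fq ^+ d) k
            * qpochs (aneg d fa fq^-1) (fq ^+ d) k
            * qpoch fq^-1 (fq ^+ d) k)
           / (qpochs (apos d fa (fq ^+ d)) (fq ^+ d) k
              * qpochs (aneg d fa (fq ^+ d)) (fq ^+ d) k
              * qpoch (fq ^+ d) (fq ^+ d) k))
        * fq ^+ (d * (d - 1) * k %/ 2)%N)
    (Phiq n * (1 - pa * pq ^+ n) * (pa - pq ^+ n)).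
Proof.
have [g dE] : exists g, d = (2 * g + 3)%N by exists (d - 3)./2; lia.
subst d; have [mu nE] : exists mu, n = ((2 * g + 3) * mu + g + 2)%N.
  have := divn_eq (2 * n) (2 * g + 3); rewrite hn modn_small; last by lia.
  set c := (_ %/ _)%N => E; exists c./2.
  have oddc : odd c.
    by have := congr1 odd E; rewrite oddD !oddM oddD oddM /= andbT addbT => /esym/negbFE.
  by move: E; rewrite -{1}(odd_double_half c) oddc -mul2n; lia.
have [z z_prim] := C_prim_root_exists hn0.
rewrite nE in z_prim.
have [x [w [w0 sumE xE]]] := specializes_sum_summand z_prim.
have fa0 : fa != 0 by rewrite tofrac_eq0 polyX_eq0.
have fq0 : fq != 0 by rewrite tofrac_eq0 polyC_eq0 polyX_eq0.
rewrite big_mkord; under eq_bigr do rewrite summandE //.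
rewrite nE sumE -/(tof x) -/(tof w).
set m := (_ + 2)%N in z_prim *.
have x0 i : at_place g mu z i x = 0 by rewrite xE mul0r.
have ker i := divides_place_factor z_prim (i := i).
have root i := place_factor_eq0 z_prim i.
have PhiX := Phiq_place_neq0 g mu z.
have [U UE] : divides (Phiq m * (1 - pa * pq ^+ m) * (pa - pq ^+ m)) x.
  apply: (divides_mul_kernel (ker AtPower)) (x0 _); last first.
    by rewrite rmorphM mulf_neq0 ?PhiX //; exact: inv_factor_at_power_neq0.
  apply: (divides_mul_kernel (ker AtInvPower)) (x0 _); last exact: PhiX.
  exact: (ker AtRoot).
exists U, w; split; last by rewrite -UE.
  by apply: contraNneq (w0 AtRoot) => ->; rewrite rmorph0.
have step i P := relprime_mul_kernel (P := P) (ker i) (place_factor_neq0 z_prim i)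
  (root i) (w0 i).
have := step AtPower _ (step AtInvPower _ (step AtRoot _ (@relprime1 _ w))).
by rewrite mul1r.
Qed.
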